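(* Let $n\ge 1$, let $K$ be a norm on $\mathbb{R}^n$ and let $K^\circ$ be the dual norm of $K$. Take any $\mu\in\mathbb{R}^n$ and $\sigma>0$, and let $Y\sim N_n(\mu,\sigma^2 I_n)$. Let $\hat\sigma$ be any random variable defined on the same probability space as $Y$. Define \[ \hat\mu := \operatorname{argmin}\{K(\nu): \nu\in\mathbb{R}^n,\ \|Y-\nu\|^2\le n\hat\sigma^2\}. \] Let $Z\sim N_n(0,I_n)$. Then \[ \frac{\mathbb{E}\|\hat\mu-\mu\|^2}{n\sigma^2}\le \frac{16}{n\sigma}K(\mu)\,\mathbb{E}(K^\circ(Z)) + 2\sqrt{\frac{2}{n}} + \frac{2\,\mathbb{E}|\hat\sigma^2-\sigma^2|}{\sigma^2}. \]
   Context: $\|\cdot\|$ is the Euclidean norm on $\mathbb{R}^n$ and $x\cdot y$ is the standard inner product. $N_n(\mu,\sigma^2 I_n)$ denotes the $n$-dimensional Gaussian distribution with mean vector $\mu$ and covariance matrix $\sigma^2 I_n$, where $I_n$ is the $n\times n$ identity matrix. The dual norm of a norm $K$ on $\mathbb{R}^n$ is $K^\circ(x)=\sup_{y\ne 0}\frac{x\cdot y}{K(y)}$. No independence between $\hat\sigma$ and $Y$ is assumed. *)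

(* Defs.v *)
From mathcomp Require Import all_boot all_order all_algebra.
From mathcomp Require Import all_classical all_reals all_analysis.

Set Implicit Arguments.
Unset Strict Implicit.
Unset Printing Implicit Defensive.

Import Order.TTheory GRing.Theory Num.Theory.
Import numFieldNormedType.Exports.

Local Open Scope classical_set_scope.
Local Open Scope ring_scope.

Definition dotprod (R : realType) (n : nat) (x y : 'rV[R]_n) : R :=
  \sum_(i < n) x ord0 i * y ord0 i.

(* The library norm `|x| on 'rV[R]_n is the sup norm, hence this one. *)
Definition euclidean_norm (R : realType) (n : nat) (x : 'rV[R]_n) : R :=
  Num.sqrt (dotprod x x).

Definition is_norm (R : realType) (n : nat) (K : 'rV[R]_n -> R) : Prop :=
  [/\ forall x, 0 <= K x,
      forall x, K x = 0 -> x = 0,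
      forall (a : R) x, K (a *: x) = `|a| * K x
    & forall x y, K (x + y) <= K x + K y].

Definition dual_norm (R : realType) (n : nat) (K : 'rV[R]_n -> R)
    (x : 'rV[R]_n) : R :=
  sup [set dotprod x y / K y | y in [set y | y != 0]].

Definition is_argmin (R : realType) (V : Type) (f : V -> R) (A : set V)
    (x : V) : Prop :=
  A x /\ forall y, A y -> f x <= f y.

(* The default value 0 is returned only when there is no minimizer. *)
Definition argmin (R : realType) (n : nat) (f : 'rV[R]_n -> R)
    (A : set 'rV[R]_n) : 'rV[R]_n :=
  xget 0 [set x | is_argmin f A x].

(* R^n with its Borel sigma-algebra; it is convertible to 'rV[R]_n. *)
Notation borel_rV R n := (g_sigma_algebraType (@open 'rV[R]_n)).

(* Lebesgue integral over R^n of a nonnegative Borel function, computed by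
   Tonelli's theorem as an iterated integral over the coordinates. *)
Fixpoint lebesgue_integral_rV (R : realType) (n : nat) :
    ('rV[R]_n -> \bar R) -> \bar R :=
  match n return ('rV[R]_n -> \bar R) -> \bar R with
  | 0%N => fun f => f 0
  | m.+1 => fun f =>
      (\int[@lebesgue_measure R]_x
        lebesgue_integral_rV
          (fun v : 'rV[R]_m => f (row_mx (const_mx x : 'rV[R]_1) v)))%E
  end.

(* Meaningful for a symmetric positive definite covariance matrix Sigma. *)
Definition gaussian_pdf (R : realType) (n : nat) (mu : 'rV[R]_n)
    (Sigma : 'M[R]_n) (x : 'rV[R]_n) : R :=
  expR (- dotprod ((x - mu) *m invmx Sigma) (x - mu) / 2)
    / Num.sqrt ((2 * pi) ^+ n * \det Sigma).

Definition gaussian_measure (R : realType) (n : nat) (mu : 'rV[R]_n)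
    (Sigma : 'M[R]_n) (A : set 'rV[R]_n) : \bar R :=
  lebesgue_integral_rV (fun x => (gaussian_pdf mu Sigma x * \1_A x)%:E).

Definition has_gaussian_law (d : measure_display) (T : measurableType d)
    (R : realType) (P : probability T R) (n : nat)
    (X : {RV P >-> borel_rV R n}) (mu : 'rV[R]_n) (Sigma : 'M[R]_n) : Prop :=
  forall A : set (borel_rV R n), measurable A ->
    distribution P X A = gaussian_measure mu Sigma A.

(* Main.v *)
Require Import Defs.
From HB Require Import structures.
From mathcomp Require Import all_boot all_order all_algebra.
From mathcomp Require Import all_classical all_reals all_analysis.
From mathcomp Require Import measurable_realfun ring lra.

(** Write L = n sigma_hat^2.  Since mu_hat minimizes K over the ball
    ||Y - nu||^2 <= L, one of two things happens.  If K mu_hat <= K mu, expanding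
    ||Y - mu_hat||^2 <= L around mu and using duality gives
    ||mu_hat - mu||^2 <= L - ||Y - mu||^2 + 4 K(mu) K°(Y - mu).
    If K mu < K mu_hat, the open segment from mu_hat to mu decreases K and so
    avoids the ball; the resulting obtuse angle at mu_hat gives
    ||mu_hat - mu||^2 <= ||Y - mu||^2 - L.  Either way
    ||mu_hat - mu||^2 <= 4 K(mu) K°(Y - mu) + | ||Y - mu||^2 - n sigma^2 |
                         + n |sigma_hat^2 - sigma^2|,
    and it remains to take expectations, with E | ||Z||^2 - n | <= sqrt (2n). *)

Set Implicit Arguments.
Unset Strict Implicit.
Unset Printing Implicit Defensive.

Import Order.TTheory GRing.Theory Num.Theory.
Import numFieldNormedType.Exports.

Local Open Scope classical_set_scope.
Local Open Scope ring_scope.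

(** * Norms on row vectors and the minimizer over a ball *)

Section dotprod.
Context {R : realType} {n : nat}.
Implicit Types (x y z : 'rV[R]_n) (a : R).

Lemma dotprodC x y : dotprod x y = dotprod y x.
Proof. by apply: eq_bigr => i _; rewrite mulrC. Qed.

Lemma dotprodDl x y z : dotprod (x + y) z = dotprod x z + dotprod y z.
Proof. by rewrite -big_split; apply: eq_bigr => i _; rewrite mxE mulrDl. Qed.

Lemma dotprodZl a x y : dotprod (a *: x) y = a * dotprod x y.
Proof. by rewrite /dotprod big_distrr/=; apply: eq_bigr => i _; rewrite mxE mulrA. Qed.

Lemma dotprodNl x y : dotprod (- x) y = - dotprod x y.
Proof. by rewrite -scaleN1r dotprodZl mulN1r. Qed.

Lemma dotprodDr x y z : dotprod x (y + z) = dotprod x y + dotprod x z.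
Proof. by rewrite dotprodC dotprodDl !(dotprodC _ x). Qed.

Lemma dotprodZr a x y : dotprod x (a *: y) = a * dotprod x y.
Proof. by rewrite dotprodC dotprodZl dotprodC. Qed.

Lemma dotprodNr x y : dotprod x (- y) = - dotprod x y.
Proof. by rewrite dotprodC dotprodNl dotprodC. Qed.

Lemma dotprod_sqrDZ a x y : dotprod (x + a *: y) (x + a *: y) =
  dotprod x x + 2 * a * dotprod x y + a ^+ 2 * dotprod y y.
Proof.
by rewrite dotprodDl !dotprodDr !dotprodZr !dotprodZl (dotprodC y x); ring.
Qed.

Lemma dotprod_ge0 x : 0 <= dotprod x x.
Proof. by apply: sumr_ge0 => i _; rewrite -expr2 sqr_ge0. Qed.

Lemma dotprod_coord x i : x ord0 i ^+ 2 <= dotprod x x.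
Proof.
rewrite /dotprod (bigD1 i)//= -expr2 lerDl.
by apply: sumr_ge0 => j _; rewrite -expr2 sqr_ge0.
Qed.

Lemma euclidean_norm_sqr x : euclidean_norm x ^+ 2 = dotprod x x.
Proof. by rewrite sqr_sqrtr// dotprod_ge0. Qed.

Lemma coord_le_norm x i : `|x ord0 i| <= `|x|.
Proof.
rewrite [leRHS]/Num.norm/= mx_normrE.
by apply/bigmax_geP; right => /=; exists (ord0, i).
Qed.

Lemma norm_le_coord x (M : R) : 0 <= M ->
  (forall i, `|x ord0 i| <= M) -> `|x| <= M.
Proof.
move=> M0 xM; rewrite [leLHS]/Num.norm/= mx_normrE.
by apply/bigmax_leP; split => // -[i j] _ /=; rewrite (ord1 i).
Qed.

(** Hölder's inequality for the pair l1, l-infinity: the norm of [y] here is the sup norm. *)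
Lemma ler_dotprod_norm x y : dotprod x y <= (\sum_(i < n) `|x ord0 i|) * `|y|.
Proof.
rewrite big_distrl/=; apply: ler_sum => i _.
rewrite (le_trans (ler_norm _))// normrM ler_wpM2l//; exact: coord_le_norm.
Qed.

Lemma continuous_dotprodxx y :
  continuous (fun x : 'rV[R]_n => dotprod (y - x) (y - x)).
Proof.
move=> x; apply: (@cvg_big _ _ _ _ _ _ _ (nbhs x)) => [|i _].
  exact: add_continuous.
suff h : y ord0 i - z ord0 i @[z --> x] --> y ord0 i - x ord0 i.
  under eq_fun do rewrite !mxE.
  by rewrite !mxE; apply: cvgM.
apply: (@cvgB _ R^o _ (nbhs x) _ (cst (y ord0 i)) (fun z : 'rV[R]_n => z ord0 i)).
  exact: cvg_cst.
exact: coord_continuous.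
Qed.

(* A subadditive function dominated by a norm is Lipschitz. *)
Lemma subadditive_continuous (N : 'rV[R]_n -> R) (C : R) :
  (forall x, N x <= C * `|x|) -> (forall x y, N (x + y) <= N x + N y) ->
  continuous N.
Proof.
move=> NC ND x.
(* [C] may be zero or negative, so a positive Lipschitz constant is taken, by which [e] can be
   divided. *)
have C0 : 0 <= `|C| + 1 by rewrite addr_ge0.
have lipN (u v : 'rV[R]_n) : N u - N v <= (`|C| + 1) * `|u - v|.
  rewrite lerBlDr -{1}(subrK v u) (le_trans (ND _ _))// lerD2r.
  by rewrite (le_trans (NC _))// ler_wpM2r// (le_trans (ler_norm _))// lerDl.
apply/(@cvgrPdist_le _ _ _ (nbhs x)) => e e0; near=> y.
apply: (@le_trans _ _ ((`|C| + 1) * `|x - y|)).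
  by rewrite ler_norml lipN andbT lerNl opprB distrC lipN.
rewrite mulrC -ler_pdivlMr ?ltr_wpDl//.
near: y; have /cvgrPdist_le := @cvg_id _ (nbhs x); apply.
by rewrite divr_gt0// ltr_wpDl.
Unshelve. all: by end_near. Qed.

End dotprod.

(** * Equivalence with the sup norm, and the dual norm *)

Section dual_norm.
Context {R : realType} {n : nat}.
Variable K : 'rV[R]_n -> R.
Hypothesis K_norm : is_norm K.
Implicit Types x y : 'rV[R]_n.

Let K_ge0 x : 0 <= K x. Proof. by case: K_norm. Qed.
Let K_eq0 x : K x = 0 -> x = 0. Proof. by case: K_norm => _ + _ _; exact. Qed.
Let KZ a x : K (a *: x) = `|a| * K x. Proof. by case: K_norm => _ _ + _; exact. Qed.
Let KD x y : K (x + y) <= K x + K y. Proof. by case: K_norm => _ _ _; exact. Qed.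

Lemma is_norm0 : K 0 = 0.
Proof. by rewrite -(scale0r 0) KZ normr0 mul0r. Qed.

Lemma is_norm_gt0 x : x != 0 -> 0 < K x.
Proof. by move=> /eqP x0; rewrite lt0r K_ge0 andbT; apply/eqP => /K_eq0. Qed.

Lemma is_normN x : K (- x) = K x.
Proof. by rewrite -scaleN1r KZ normrN1 mul1r. Qed.

(** The triangle inequality on the expansion of [x] in the standard basis. *)
Lemma is_norm_ub x : K x <= (\sum_(i < n) K (delta_mx ord0 i)) * `|x|.
Proof.
rewrite big_distrl/= {1}(row_sum_delta x).
elim/big_ind2 : _ => //; first by rewrite is_norm0.
  by move=> u a v b ua vb; rewrite (le_trans (KD _ _))// lerD.
by move=> i _; rewrite KZ mulrC ler_wpM2l// coord_le_norm.
Qed.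

Lemma is_norm_continuous : continuous K.
Proof. exact: subadditive_continuous is_norm_ub KD. Qed.

(** [K] is continuous and positive on the compact unit sphere of the sup norm, so its minimum there
    is a positive [c]; homogeneity extends the bound to all [x]. This keeps the set defining
    [dual_norm] bounded. *)
Lemma is_norm_lb : exists2 c : R, 0 < c & forall x, c * `|x| <= K x.
Proof.
pose S := [set x : 'rV[R]_n | `|x| = 1].
have [S0|] := pselect (S !=set0); last first.
  (* An empty sphere forces every [x] to be 0 (dimension 0), and any positive constant works. *)
  move=> S0; exists 1 => // x; have [->|x0] := eqVneq x 0.
    by rewrite normr0 mulr0.
  exfalso; apply: S0; exists (`|x|^-1 *: x).
  by rewrite /S/= normrZ normfV normr_id mulVf// normr_eq0.
have cS : compact S.
  apply: bounded_closed_compact.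
    exists 1; split => // M M1 x /= ->; exact: ltW.
  have -> : S = (fun x : 'rV[R]_n => `|x|) @^-1` [set 1] by [].
  by apply: closed_comp => // x _; exact: norm_continuous.
have [c /[!inE] cS1 cmin] := EVT_min_rV S0 cS (continuous_subspaceT is_norm_continuous).
have c0 : c != 0.
  by apply/eqP => c0; move: cS1; rewrite /S/= c0 normr0 => /esym/eqP; rewrite oner_eq0.
exists (K c); first exact: is_norm_gt0.
move=> x; have [->|x0] := eqVneq x 0; first by rewrite normr0 mulr0.
have nx : 0 < `|x| by rewrite normr_gt0.
have := cmin (`|x|^-1 *: x).
rewrite inE KZ normfV normr_id ler_pdivlMl// mulrC; apply.
by rewrite /S/= normrZ normfV normr_id mulVf// gt_eqF.
Qed.

Let D x := [set dotprod x y / K y | y in [set y | y != 0]].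

Let D_ub x (M : R) : 0 <= M -> (forall y, dotprod x y <= M * K y) -> ubound (D x) M.
Proof.
move=> M0 h _ [y /= y0 <-]; by rewrite ler_pdivrMr ?is_norm_gt0.
Qed.

Let D_has_ubound x : has_ubound (D x).
Proof.
have [c c0 cK] := is_norm_lb.
have S0 : 0 <= \sum_(i < n) `|x ord0 i| by exact: sumr_ge0.
exists ((\sum_(i < n) `|x ord0 i|) / c); apply: D_ub; first by rewrite divr_ge0// ltW.
move=> y; rewrite (le_trans (ler_dotprod_norm _ _))// -mulrA ler_wpM2l//.
by rewrite ler_pdivlMl.
Qed.

(** In dimension 0 the supremum is over the empty set and takes its default value 0, which [0 <= M]
    covers. *)
Lemma dual_norm_le x (M : R) : 0 <= M ->
  (forall y, dotprod x y <= M * K y) -> dual_norm K x <= M.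
Proof.
move=> M0 h; have [D0|D0] := pselect (D x !=set0).
  by apply: ge_sup => //; exact: D_ub.
by rewrite /dual_norm sup_out//; case.
Qed.

Lemma dotprod_le_dual_norm x y : dotprod x y <= dual_norm K x * K y.
Proof.
have [->|y0] := eqVneq y 0.
  by rewrite is_norm0 mulr0 -(scale0r 0) dotprodZr mul0r.
rewrite -ler_pdivrMr ?is_norm_gt0//; apply: (ub_le_sup (D_has_ubound x)).
by exists y.
Qed.

(** For x nonzero, testing against [x] itself gives 0 <= x.x <= K°(x) K(x) with K(x) > 0. For x = 0
    every quotient is 0. *)
Lemma dual_norm_ge0 x : 0 <= dual_norm K x.
Proof.
have [->|x0] := eqVneq x 0.
  have [[z [y y0 _]]|D0] := pselect (D 0 !=set0); last first.
    by rewrite /dual_norm sup_out//; case.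
  apply: (ub_le_sup (D_has_ubound 0)); exists y => //.
  by rewrite -(scale0r 0) dotprodZl !mul0r.
rewrite -(pmulr_lge0 _ (is_norm_gt0 x0)).
exact: le_trans (dotprod_ge0 x) (dotprod_le_dual_norm x x).
Qed.

Lemma dual_normD x y : dual_norm K (x + y) <= dual_norm K x + dual_norm K y.
Proof.
apply: dual_norm_le => [|z]; first by rewrite addr_ge0// dual_norm_ge0.
by rewrite dotprodDl mulrDl lerD// dotprod_le_dual_norm.
Qed.

Lemma dual_normZ_le a x : 0 <= a -> dual_norm K (a *: x) <= a * dual_norm K x.
Proof.
move=> a0; apply: dual_norm_le => [|z]; first by rewrite mulr_ge0// dual_norm_ge0.
by rewrite dotprodZl -mulrA ler_wpM2l// dotprod_le_dual_norm.
Qed.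

(** Subadditivity and domination by a multiple of the sup norm give continuity, from which the
    measurability of K°(Z) will follow. *)
Lemma dual_norm_continuous : continuous (dual_norm K).
Proof.
have [c c0 cK] := is_norm_lb.
apply: (@subadditive_continuous _ _ _ (n%:R / c)) dual_normD => x.
apply: dual_norm_le => [|y]; first by rewrite !mulr_ge0// invr_ge0 ltW.
apply: le_trans (ler_dotprod_norm _ _) _.
rewrite -[leRHS]mulrA mulrACA ler_pM ?sumr_ge0//; last by rewrite ler_pdivlMl.
rewrite mulr_natl -[leRHS](_ : \sum_(i < n) `|x| = _); last first.
  by rewrite sumr_const card_ord.
by apply: ler_sum => i _; exact: coord_le_norm.
Qed.

End dual_norm.

(** * The deterministic inequality for the minimizer *)

Section argmin_ball.
Context {R : realType} {n : nat}.
Variable K : 'rV[R]_n -> R.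
Hypothesis K_norm : is_norm K.
Variables (y : 'rV[R]_n) (L : R).
Hypothesis L_ge0 : 0 <= L.

Let B := [set nu : 'rV[R]_n | euclidean_norm (y - nu) ^+ 2 <= L].

(** The ball contains [y] because [0 <= L], and it is compact, so the continuous [K] attains its
    minimum on it. Hence [argmin] does not fall back on its default value. *)
Lemma argmin_ballP : is_argmin K B (argmin K B).
Proof.
suff [m Bm mK] : exists2 m, B m & forall nu, B nu -> K m <= K nu.
  by rewrite /argmin; apply: (@xgetPex _ 0 [set x | is_argmin K B x]); exists m.
have B0 : B !=set0.
  by exists y; rewrite /B/= euclidean_norm_sqr subrr -(scale0r 0) dotprodZl mul0r.
have BE : B = (fun nu => dotprod (y - nu) (y - nu)) @^-1` [set r | r <= L].
  by apply/seteqP; split => nu; rewrite /B/= euclidean_norm_sqr.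
have cB : compact B.
  apply: bounded_closed_compact; last first.
    rewrite BE; apply: closed_comp; last exact: closed_le.
    by move=> nu _; exact: continuous_dotprodxx.
  exists (`|y| + Num.sqrt L); split; first exact: num_real.
  move=> M yLM nu; rewrite BE/= => nuL.
  apply: le_trans (ltW yLM).
  rewrite -[nu](subKr y) (le_trans (ler_normB _ _))// lerD2l.
  apply: norm_le_coord => [|i]; first exact: sqrtr_ge0.
  rewrite -sqrtr_sqr ler_sqrt//; exact: le_trans (dotprod_coord _ _) nuL.
have [m /[!inE] Bm mK] :=
  EVT_min_rV B0 cB (continuous_subspaceT (is_norm_continuous K_norm)).
by exists m => // nu Bnu; apply: mK; rewrite inE.
Qed.

Lemma argmin_ball_sqr_dist_le (mu : 'rV[R]_n) :
  let m := argmin K B in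
  euclidean_norm (m - mu) ^+ 2 <=
    4 * K mu * dual_norm K (y - mu) + `|dotprod (y - mu) (y - mu) - L|.
Proof.
have [] := argmin_ballP; set m := argmin K B => Bm mK /=.
rewrite euclidean_norm_sqr.
rewrite /B/= euclidean_norm_sqr in Bm.
have [K_ge0 _ KZ KD] := K_norm.
set a := dotprod (y - m) (y - m) in Bm.
set b := dotprod (y - m) (m - mu).
set c := dotprod (m - mu) (m - mu).
have c_ge0 : 0 <= c by exact: dotprod_ge0.
have DK_ge0 := dual_norm_ge0 K_norm (y - mu).
have ymu : dotprod (y - mu) (y - mu) = a + 2 * b + c.
  rewrite (_ : y - mu = (y - m) + 1 *: (m - mu)); last first.
    by rewrite scale1r addrA subrK.
  by rewrite dotprod_sqrDZ mulr1 expr1n mul1r.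
have [mmu|mum] := leP (K m) (K mu).
  (* Here c = 2(b + c) - ||y - mu||^2 + a, where a <= L and K(m - mu) <= 2 K(mu). *)
  have : dotprod (y - mu) (m - mu) <= dual_norm K (y - mu) * (2 * K mu).
    rewrite (le_trans (dotprod_le_dual_norm K_norm _ _))// ler_wpM2l//.
    by rewrite (le_trans (KD _ _))// (is_normN K_norm); lra.
  have -> : dotprod (y - mu) (m - mu) = b + c.
    by rewrite /b /c -dotprodDl addrA subrK.
  have := ler_norm (- (dotprod (y - mu) (y - mu) - L)); rewrite normrN ymu; nra.
(* Moving from m towards mu strictly decreases K, hence leaves the ball. *)
have out t : 0 < t -> t <= 1 -> L < a + 2 * t * b + t ^+ 2 * c.
  move=> t0 t1; rewrite ltNge; apply/negP => tB.
  have /mK : B (m + (- t) *: (m - mu)).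
    rewrite /B/= euclidean_norm_sqr.
    rewrite (_ : y - _ = (y - m) + t *: (m - mu)); last first.
      by rewrite opprD scaleNr opprK addrA.
    by rewrite dotprod_sqrDZ.
  rewrite leNgt => /negP; apply.
  rewrite (_ : m + _ = (1 - t) *: m + t *: mu); last first.
    by apply/rowP => i; rewrite !mxE; ring.
  have tK : t * K mu < t * K m by rewrite ltr_pM2l.
  rewrite (le_lt_trans (KD _ _))// !KZ (ger0_norm (ltW t0)) ger0_norm ?subr_ge0//.
  nra.
(* If b < 0, the choice of [t] gives t^2 c <= -t b, so the moved point is still in the ball: a + 2 t
   b + t^2 c <= a + t b < L. The [+ 1] keeps the denominator positive. *)
have b_ge0 : 0 <= b.
  rewrite leNgt; apply/negP => b0.
  pose t := Num.min 1 (- b / (c + 1)).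
  have t0 : 0 < t by rewrite lt_min ltr01 divr_gt0//; lra.
  have t1 : t <= 1 by rewrite ge_min lexx.
  have tb : t * (c + 1) <= - b.
    by rewrite -ler_pdivlMr ?ge_min ?lexx ?orbT//; lra.
  have := out t t0 t1; nra.
(* If a < L, a small step stays in the ball, since a + 2 t b + t^2 c <= a + t (2b + c) <= L, against
   [out]. *)
have La : L <= a.
  rewrite leNgt; apply/negP => aL.
  pose t := Num.min 1 ((L - a) / (2 * b + c + 1)).
  have t0 : 0 < t by rewrite lt_min ltr01 divr_gt0//; lra.
  have t1 : t <= 1 by rewrite ge_min lexx.
  have tb : t * (2 * b + c + 1) <= L - a.
    by rewrite -ler_pdivlMr ?ge_min ?lexx ?orbT//; lra.
  have : t ^+ 2 * c <= t * c by rewrite ler_wpM2r// expr2 ler_piMr// ltW.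
  have := out t t0 t1; lra.
(* Now c = ||y - mu||^2 - a - 2b <= ||y - mu||^2 - L, and the dual norm term is nonnegative. *)
have := ler_norm (dotprod (y - mu) (y - mu) - L); rewrite ymu.
have := mulr_ge0 (K_ge0 mu) DK_ge0; lra.
Qed.
End argmin_ball.

(** * Borel measurability on row vectors *)

Section measurable_rV.
Context {R : realType}.

Lemma continuous_measurable_rV n (f : 'rV[R]_n -> R) : continuous f ->
  measurable_fun [set: borel_rV R n] (f : borel_rV R n -> R).
Proof.
move=> cf; apply: (measurability _ (RGenOInfty.measurableE R)).
move=> _ [_ [x ->] <-]; rewrite setTI; apply: sub_sigma_algebra.
by apply: open_comp => [v _|]; [exact: cf|exact: interval_open].
Qed.

Lemma measurable_coord n (i : 'I_n) :
  measurable_fun [set: borel_rV R n] (fun v : borel_rV R n => (v : 'rV[R]_n) ord0 i).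
Proof. by apply: continuous_measurable_rV => v; exact: coord_continuous. Qed.

(* Open sets are countable unions of rational boxes. *)
Lemma measurable_fun_rV d (T : measurableType d) n (f : T -> 'rV[R]_n) :
  (forall i, measurable_fun [set: T] (fun t => f t ord0 i)) ->
  measurable_fun [set: T] (f : T -> borel_rV R n).
Proof.
move=> mf.
pose box (p : 'rV[rat]_n * nat) : set 'rV[R]_n :=
  [set v | forall i, `|v ord0 i - ratr (p.1 ord0 i)| < p.2.+1%:R^-1].
have mbox p : measurable (f @^-1` box p).
  rewrite (_ : f @^-1` box p = \big[setI/setT]_(i < n)
    [set t | `|f t ord0 i - ratr (p.1 ord0 i)| < p.2.+1%:R^-1]); last first.
    apply/seteqP; split => t /=.
      by move=> pt; rewrite -bigcap_seq => i _; exact: pt.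
    by rewrite -bigcap_seq => pt i; apply: pt; rewrite /= mem_index_enum.
  apply: bigsetI_measurable => i _.
  rewrite (_ : [set _ | _] = [set: T] `&` (fun t => f t ord0 i) @^-1`
      `](ratr (p.1 ord0 i) - p.2.+1%:R^-1), (ratr (p.1 ord0 i) + p.2.+1%:R^-1)[).
    exact: mf.
  by rewrite setTI; apply/seteqP; split => t/=; rewrite in_itv/= ltr_distl.
apply: (@measurability _ _ T (borel_rV R n) setT f (@open 'rV[R]_n) erefl).
move=> _ [U oU <-].
rewrite setTI.
(* The index set is countable; a box that is not contained in [U] contributes the empty set. *)
rewrite (_ : f @^-1` U = \bigcup_p
    (if `[< box p `<=` U >] then f @^-1` box p else set0)); last first.
  apply/seteqP; split => t /=; last first.
    by move=> [p _]; case: asboolP => // pU /pU.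
  move=> Ut; have /nbhs_normP[e /= e0 eU] : nbhs (f t) U by exact: open_nbhs_nbhs.
  have [k ke] : exists k : nat, k.+1%:R^-1 < e / 2.
    have e2 : 0 < e / 2 by rewrite divr_gt0.
    have [k _ ke] := near_infty_natSinv_lt (PosNum e2).
    by exists k; exact: (ke k (leqnn k)).
  have h i : exists q : rat, `|f t ord0 i - ratr q| < k.+1%:R^-1.
    have : f t ord0 i - k.+1%:R^-1 < f t ord0 i + k.+1%:R^-1 by rewrite ltrD2l gtrN.
    by move=> /rat_in_itvoo[q]; rewrite in_itv/= -ltr_distl distrC; exists q.
  have [q fq] := choice h.
  exists (\row_i q i, k) => //=.
  case: asboolP => [_ i|]; first by rewrite mxE.
  move=> nbox; exfalso; apply: nbox => v vq; apply: eU => /=.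
  (* [v] and [f t] lie in the same box, each coordinate within 1/(k+1) of its centre, so they are
     closer than [e]. *)
  apply: (@le_lt_trans _ _ (2 * k.+1%:R^-1)); last by rewrite mulrC -ltr_pdivlMr.
  apply: norm_le_coord => [|i]; first by rewrite mulr_ge0.
  have := fq i; have := vq i; rewrite !mxE/= => vqi fqi.
  rewrite mulr_natl mulr2n.
  rewrite -[_ - _](subrKA (ratr (q i)))  (le_trans (ler_normD _ _))// lerD// ?ltW//.
  by rewrite distrC.
apply: countable_bigcupT_measurable => [|p]; first exact: countableP.
by case: asboolP.
Qed.

(** Prepends a coordinate, in the very form used by the recursion of [lebesgue_integral_rV]. *)
Definition row_const_mx n (p : measurableTypeR R * borel_rV R n) : borel_rV R n.+1 :=
  row_mx (const_mx p.1 : 'rV[R]_1) p.2.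

Lemma measurable_row_const_mx n :
  measurable_fun [set: measurableTypeR R * borel_rV R n] (@row_const_mx n).
Proof.
apply: measurable_fun_rV => i.
case: (split_ordP (i : 'I_(1 + n))) => j ->.
  rewrite (_ : (fun _ => _) = fst); first exact: measurable_fst.
  by apply/funext => p; rewrite (@row_mxEl R 1 1 n) mxE.
rewrite (_ : (fun _ => _) = (fun v : borel_rV R n => (v : 'rV[R]_n) ord0 j) \o snd).
  by apply: (measurableT_comp (measurable_coord j)); exact: measurable_snd.
by apply/funext => p; rewrite (@row_mxEr R 1 1 n).
Qed.

Lemma measurable_affine_rV n (mu : 'rV[R]_n) (s : R) : measurable_fun
  [set: borel_rV R n] ((fun z => mu + s *: (z : 'rV[R]_n)) : _ -> borel_rV R n).
Proof.
apply: measurable_fun_rV => i; under eq_fun do rewrite !mxE.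
apply: measurable_funD => //; apply: measurable_funM => //.
exact: measurable_coord.
Qed.

End measurable_rV.
Arguments measurable_coord {R n} i.
Arguments measurable_row_const_mx {R} n.
Arguments measurable_affine_rV {R n} mu s.

(** * Gaussian measures *)

Section normal_integral.
Local Open Scope ereal_scope.
Context {R : realType}.
Notation lebesgue := (@lebesgue_measure R).

(** The Radon-Nikodym derivative of [normal_prob] equals [normal_pdf] almost everywhere, because
    both have the same integral over every measurable set. *)
Lemma ge0_integral_normal_prob (m s : R) (f : R -> \bar R) :
  measurable_fun [set: measurableTypeR R] f -> (forall x, 0 <= f x) ->
  \int[normal_prob m s]_x f x = \int[lebesgue]_x ((normal_pdf m s x)%:E * f x).
Proof.
move=> mf f0; have dom := normal_prob_dominates m s.
have mpdf : measurable_fun [set: measurableTypeR R] (EFin \o normal_pdf m s).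
  by apply/measurable_EFinP; exact: measurable_normal_pdf.
rewrite -(Radon_Nikodym_SigmaFinite.change_of_variables dom)//.
have iRN := Radon_Nikodym_SigmaFinite.f_integrable dom.
apply: ae_eq_integral => //.
- by apply: emeasurable_funM => //; exact: (measurable_int _ iRN).
- exact: emeasurable_funM.
- under [X in ae_eq _ _ _ X]eq_fun do rewrite muleC.
  apply: ae_eqe_mul2l; apply: integral_ae_eq => //.
  by move=> A AT mA; rewrite -Radon_Nikodym_SigmaFinite.f_integral.
Qed.

(** Lebesgue measure is [s] times its pushforward under x -> m + s x: the two agree on half-open
    intervals, which determine the measure. *)
Lemma ge0_integral_affine (m s : R) (f : R -> \bar R) : (0 < s)%R ->
  measurable_fun [set: measurableTypeR R] f -> (forall x, 0 <= f x) ->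
  \int[lebesgue]_x f x = \int[lebesgue]_x (s%:E * f (m + s * x)%R).
Proof.
move=> s0 mf f0.
pose phi : measurableTypeR R -> measurableTypeR R := fun x => (m + s * x)%R.
have mphi : measurable_fun [set: measurableTypeR R] phi.
  by apply: measurable_funD => //; exact: measurable_funM.
have [pf pfE] : exists pf : {measure set (measurableTypeR R) -> \bar R},
    forall A, pf A = lebesgue (phi @^-1` A).
  by exists (pushforward lebesgue phi).
pose nu : {measure set (measurableTypeR R) -> \bar R} :=
  mscale (NngNum (ltW s0)) pf.
have nuE A : measurable A -> lebesgue A = nu A.
  apply: lebesgue_measure_unique => _ [[a b] _ <-].
  rewrite [RHS](_ : _ = s%:E * lebesgue (phi @^-1` `]a, b]%classic)); last first.
    by rewrite -pfE.
  rewrite (_ : phi @^-1` _ = `]((a - m) / s)%R, ((b - m) / s)%R]%classic); last first.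
    apply/seteqP; split => x /=; rewrite !in_itv/= /phi ltr_pdivrMr// ler_pdivlMr// ltrBlDl lerBrDl (mulrC s) //.
  rewrite !lebesgue_measure_itv/= !lte_fin ltr_pM2r ?invr_gt0// ltrD2r.
  case: ifP => ab; last by rewrite mule0.
  rewrite -!EFinB -EFinM; congr (_%:E); field; lra.
rewrite (eq_measure_integral nu); last by move=> A mA _; exact: nuE.
rewrite ge0_integral_mscale//= (eq_measure_integral (pushforward lebesgue phi)); last first.
  by move=> A mA _; exact: pfE.
rewrite ge0_integral_pushforward//= preimage_setT ge0_integralZl//.
- exact: (measurableT_comp mf mphi).
- by rewrite lee_fin ltW.
Unshelve. all: exact: mphi. Qed.

(** Substituting x = m + s z, the Jacobian [s] cancels the factor 1/s in the peak of the density. *)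
Lemma ge0_integral_normal_pdf (m s : R) (f : R -> \bar R) : (0 < s)%R ->
  measurable_fun [set: measurableTypeR R] f -> (forall x, 0 <= f x) ->
  \int[lebesgue]_x ((normal_pdf m s x)%:E * f x) =
  \int[normal_prob 0 1]_z f (m + s * z)%R.
Proof.
move=> s0 mf f0.
have maff : measurable_fun [set: measurableTypeR R] (fun x : R => m + s * x : R)%R.
  by apply: measurable_funD => //; exact: measurable_funM.
rewrite (ge0_integral_affine m s0); last 2 first.
- by apply: emeasurable_funM => //; apply/measurable_EFinP; exact: measurable_normal_pdf.
- by move=> x; rewrite mule_ge0// lee_fin normal_pdf_ge0.
rewrite ge0_integral_normal_prob//; last exact: (measurableT_comp mf maff).
apply: eq_integral => x _; rewrite muleA -EFinM; congr (_%:E * _).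
rewrite !normal_pdfE ?oner_eq0 ?gt_eqF//.
rewrite /normal_peak /normal_fun mulrA; congr (_ * expR _)%R.
  rewrite expr1n mul1r -mulrnAr [X in (s * X^-1)%R]sqrtrM ?sqr_ge0// sqrtr_sqr gtr0_norm//.
  by rewrite invfM mulrA divff ?gt_eqF// mul1r.
by field; rewrite gt_eqF.
Qed.

End normal_integral.

(** * The standard Gaussian measure and its affine images *)

Section std_gaussian.
Local Open Scope ereal_scope.
Context {R : realType}.

HB.instance Definition _ (n : nat) := isMeasurableFun.Build _ _ _ _ _
  (@measurable_row_const_mx R n).

(** The n-fold product of the standard normal law, built one coordinate at a time so that its
    integrals unfold like [lebesgue_integral_rV]. *)
Fixpoint std_gaussian n : probability (borel_rV R n) R :=
  match n with
  | 0%N => \d_((0%R : 'rV[R]_0) : borel_rV R 0)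
  | m.+1 => distribution (normal_prob 0 1 \x std_gaussian m) (@row_const_mx R m)
  end.

Lemma ge0_integral_std_gaussianS n (f : 'rV[R]_n.+1 -> \bar R) :
  measurable_fun [set: borel_rV R n.+1] f -> (forall x, 0 <= f x) ->
  \int[std_gaussian n.+1]_x f x =
  \int[normal_prob 0 1]_x \int[std_gaussian n]_v
    f (row_mx (const_mx x : 'rV[R]_1) v).
Proof.
move=> mf f0; rewrite /= ge0_integral_distribution//.
rewrite fubini_tonelli1//; last by move=> x; exact: f0.
exact: (measurableT_comp mf (measurable_row_const_mx n)).
Qed.

Lemma dotprod_row_mx n (a b : R) (u v : 'rV[R]_n) :
  dotprod (row_mx (const_mx a : 'rV_1) u) (row_mx (const_mx b : 'rV_1) v) =
  (a * b + dotprod u v)%R.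
Proof.
rewrite /dotprod (@big_split_ord _ _ _ 1 n)/= big_ord1 !row_mxEl !mxE.
by congr (_ + _)%R; apply: eq_bigr => i _; rewrite !row_mxEr.
Qed.

Lemma gaussian_pdf_scalar n (mu : 'rV[R]_n) (s : R) x : (0 < s)%R ->
  gaussian_pdf mu (s ^+ 2)%:M x = (normal_peak s ^+ n *
    expR (- dotprod (x - mu) (x - mu) / (s ^+ 2 *+ 2)))%R.
Proof.
move=> s0; rewrite /gaussian_pdf mulrC; congr (_ * expR _)%R.
  rewrite det_scalar -exprMn /normal_peak exprVn; congr (_^-1)%R.
  rewrite (_ : 2 * pi * s ^+ 2 = s ^+ 2 * pi *+ 2)%R; last by ring.
  have : (0 <= s ^+ 2 * pi *+ 2)%R by rewrite mulrn_wge0// mulr_ge0 ?sqr_ge0 ?pi_ge0.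
  (* It remains to see that sqrt(r^n) = sqrt(r)^n for r = 2 pi s^2. *)
  move: (s ^+ 2 * pi *+ 2)%R => r r0; elim: n {mu x} => [|n IHn].
    by rewrite !expr0 sqrtr1.
  by rewrite !exprS sqrtrM// IHn.
rewrite invmx_scalar mul_mx_scalar dotprodZl.
by field; rewrite gt_eqF.
Qed.

(** With a scalar covariance the exponent is a sum over coordinates, so the density factorises; this
    drives the induction on the dimension. *)
Lemma gaussian_pdf_row_mx n (m : R) (mu : 'rV[R]_n) (s x : R) v : (0 < s)%R ->
  gaussian_pdf (row_mx (const_mx m : 'rV_1) mu : 'rV_n.+1) (s ^+ 2)%:M
    (row_mx (const_mx x : 'rV_1) v) =
  (normal_pdf m s x * gaussian_pdf mu (s ^+ 2)%:M v)%R.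
Proof.
move=> s0; rewrite !gaussian_pdf_scalar// normal_pdfE ?gt_eqF// /normal_fun.
rewrite (@opp_row_mx _ 1 1 n) (@add_row_mx _ 1 1 n) (_ : const_mx x - const_mx m = const_mx (x - m))%R; last first.
  by apply/rowP => i; rewrite !mxE.
rewrite dotprod_row_mx exprS mulrACA -expRD; congr (_ * expR _)%R.
by rewrite -mulrDl -opprD expr2.
Qed.

(** Turns the iterated integral into an integral for a genuine measure. By induction on [n]: the
    density factorises, the tail is handled by the induction hypothesis at fixed [x], and the head
    by the one-dimensional substitution. *)
Lemma lebesgue_integral_rV_gaussian_pdf n (mu : 'rV[R]_n) (s : R)
    (f : 'rV[R]_n -> \bar R) : (0 < s)%R ->
  measurable_fun [set: borel_rV R n] f -> (forall x, 0 <= f x) ->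
  lebesgue_integral_rV (fun x => (gaussian_pdf mu (s ^+ 2)%:M x)%:E * f x) =
  \int[std_gaussian n]_z f (mu + s *: z)%R.
Proof.
move=> s0; elim: n mu f => [|n IHn] mu f mf f0 /=.
  rewrite integral_dirac//=; last exact: (measurableT_comp mf (measurable_affine_rV mu s)).
  rewrite diracT mul1e gaussian_pdf_scalar// /dotprod big_ord0 oppr0 mul0r expR0 mulr1 expr0 mul1e.
  by congr f; apply/rowP => -[].
have [m [mu' ->]] : exists m (mu' : 'rV[R]_n),
    mu = row_mx (const_mx m : 'rV_1) mu'.
  exists (mu ord0 ord0), (@rsubmx _ 1 1 n mu).
  rewrite -[LHS](@hsubmxK _ 1 1 n).
  suff -> : @lsubmx _ 1 1 n mu = const_mx (mu ord0 ord0) by [].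
  by apply/rowP => i; rewrite !mxE ord1; congr (mu _ _); apply: val_inj.
pose g x (v : 'rV[R]_n) := f (row_mx (const_mx x : 'rV[R]_1) v).
have mg : measurable_fun [set: measurableTypeR R * borel_rV R n] (fun p => g p.1 p.2).
  exact: (measurableT_comp mf (measurable_row_const_mx n)).
have mgx x : measurable_fun [set: borel_rV R n] (g x) by exact: (measurableT_comp mg (pair1_measurable x)).
transitivity (\int[@lebesgue_measure R]_x ((normal_pdf m s x)%:E *
    \int[std_gaussian n]_z g x (mu' + s *: z)%R)).
  apply: eq_integral => x _.
  under eq_fun do rewrite gaussian_pdf_row_mx// EFinM [X in X * _]muleC -muleA -/(g _ _).
  (* The density of the first coordinate is constant in [v], so it is absorbed into the
     integrand. *)
  rewrite (IHn mu' (fun v => (normal_pdf m s x)%:E * g x v)).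
  - rewrite ge0_integralZl//.
    + exact: (measurableT_comp (mgx x) (measurable_affine_rV mu' s)).
    + by move=> z _; exact: f0.
    + by rewrite lee_fin normal_pdf_ge0.
  - exact: emeasurable_funM.
  - by move=> v; rewrite mule_ge0// ?f0// lee_fin normal_pdf_ge0.
rewrite (ge0_integral_normal_pdf m s0); last 2 first.
- apply: (@measurable_fun_fubini_tonelli_F _ _ _ _ _ (std_gaussian n)
      (fun p => g p.1 (mu' + s *: (p.2 : 'rV_n))%R)) => [|p]; last exact: f0.
  pose h (p : measurableTypeR R * borel_rV R n) : measurableTypeR R * borel_rV R n :=
    (p.1, mu' + s *: (p.2 : 'rV_n))%R.
  have mh : measurable_fun [set: measurableTypeR R * borel_rV R n] h.
    apply: measurable_fun_pair => //.
    by apply: (measurableT_comp (measurable_affine_rV mu' s)); exact: measurable_snd.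
  exact: (measurableT_comp mg mh).
- by move=> x; apply: integral_ge0 => z _; exact: f0.
rewrite ge0_integral_std_gaussianS; last 2 first.
- exact: (measurableT_comp mf (measurable_affine_rV _ s)).
- by move=> x; exact: f0.
apply: eq_integral => x _; apply: eq_integral => z _; rewrite /g; congr f.
rewrite (@scale_row_mx _ 1 1 n) (@add_row_mx _ 1 1 n).
suff -> : (const_mx (m + s * x) = const_mx m + s *: const_mx x :> 'rV_1)%R by [].
by apply/rowP => i; rewrite !mxE.
Qed.

(** Applied to indicators, the previous lemma identifies the law of [X] with the image of
    [std_gaussian] under z -> mu + s z; a change of variables does the rest. *)
Lemma has_gaussian_lawP d (T : measurableType d) (P : probability T R) n
    (X : {RV P >-> borel_rV R n}) (mu : 'rV[R]_n) (s : R)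
    (f : 'rV[R]_n -> \bar R) : (0 < s)%R ->
  has_gaussian_law X mu (s ^+ 2)%:M ->
  measurable_fun [set: borel_rV R n] f -> (forall x, 0 <= f x) ->
  \int[P]_w f (X w) = \int[std_gaussian n]_z f (mu + s *: z)%R.
Proof.
move=> s0 XG mf f0; rewrite -(ge0_integral_distribution X)//.
have ma := measurable_affine_rV mu s.
pose aff (z : borel_rV R n) : borel_rV R n := (mu + s *: (z : 'rV[R]_n))%R.
transitivity (\int[pushforward (std_gaussian n) aff]_x f x); last first.
  by rewrite (ge0_integral_pushforward ma).
apply: eq_measure_integral => A mA _; rewrite [LHS]XG// /gaussian_measure.
under eq_fun do rewrite EFinM.
rewrite lebesgue_integral_rV_gaussian_pdf//; last first.
  exact/measurable_EFinP/measurable_indic.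
rewrite (_ : (fun _ => _) = EFin \o \1_(aff @^-1` A)).
  by rewrite integral_indic ?setIT//; rewrite -[X in measurable X]setTI; exact: ma.
by apply/funext => z; rewrite /= !indicE.
Qed.

End std_gaussian.

(** * Moment bounds *)

Section gaussian_moments.
Context {R : realType}.
Notation lebesgue := (@lebesgue_measure R).

Let phi (x : R) := normal_pdf 0 1 x.

Let phiE x : phi x = normal_peak 1 * expR (- (x ^+ 2 / 2)).
Proof. by rewrite /phi normal_pdfE ?oner_eq0// /normal_fun subr0 expr1n mulNr. Qed.

Let is_derive_phi (x : R) : is_derive x 1 phi (- x * phi x).
Proof.
rewrite (_ : phi = fun y => normal_peak 1 * expR (- (y ^+ 2 / 2))); last first.
  by apply/funext => y; rewrite phiE.
apply: is_derive_eq; rewrite /GRing.scale/=; by field.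
Qed.

Let phi_ge0 x : 0 <= phi x. Proof. exact: normal_pdf_ge0. Qed.

Let f (t x : R) := phi x * (x ^+ 2 - 1 + t) ^+ 2.

(** An antiderivative of [f t] minus (t^2 + 2) [phi], where t^2 + 2 is the value of E(X^2 - 1 + t)^2
    for a standard normal X. *)
Let F (t x : R) := - (x ^+ 3 + (2 * t + 1) * x) * phi x.

Let is_derive_F t (x : R) : is_derive x 1 (F t) (f t x - (t ^+ 2 + 2) * phi x).
Proof.
rewrite /F; have dphi := is_derive_phi x.
by apply: is_derive_eq; rewrite /GRing.scale/= /f; ring.
Qed.

Let is_derive_continuous (g dg : R -> R) :
  (forall x : R, is_derive x 1 g (dg x)) -> continuous g.
Proof.
by move=> h x; have [+ _] := h x => /derivable1_diffP/differentiable_continuous.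
Qed.

Let continuous_F t : continuous (F t).
Proof. exact: is_derive_continuous (is_derive_F t). Qed.

Let continuous_phi : continuous phi.
Proof. exact: is_derive_continuous is_derive_phi. Qed.

Let continuous_f t : continuous (f t).
Proof.
apply: (@is_derive_continuous _ (fun x => phi x * (x ^+ 2 - 1 + t) *
  (4 * x - x * (x ^+ 2 - 1 + t)))) => x.
rewrite /f; have dphi := is_derive_phi x.
by apply: is_derive_eq; rewrite /GRing.scale/=; ring.
Qed.

Let integrable_itv (g : R -> R) (a b : R) : continuous g ->
  lebesgue.-integrable `[a, b] (EFin \o g).
Proof.
move=> cg; apply: continuous_compact_integrable; first exact: segment_compact.
exact: continuous_subspaceT.
Qed.

(** As F is odd, the boundary term is -2 N (N^2 + 2t + 1) phi(N), which the hypothesis makes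
    nonpositive; the mass of [phi] on the interval is at most 1. *)
Let truncated_moment t (N : R) : 0 < N -> 0 <= N ^+ 2 + 2 * t + 1 ->
  (\int[lebesgue]_(x in `[(- N)%R, N]) (f t x)%:E <= (t ^+ 2 + 2)%:E)%E.
Proof.
move=> N0 Nt.
have c0 : 0 <= t ^+ 2 + 2 by rewrite addr_ge0// sqr_ge0.
pose g x := f t x - (t ^+ 2 + 2) * phi x.
have cg : continuous g.
  move=> x; apply: cvgB; first exact: continuous_f.
  by apply: cvgM; [exact: cvg_cst|exact: continuous_phi].
have -> : (\int[lebesgue]_(x in `[(- N)%R, N]) (f t x)%:E =
    \int[lebesgue]_(x in `[(- N)%R, N]) (g x)%:E +
    (t ^+ 2 + 2)%:E * \int[lebesgue]_(x in `[(- N)%R, N]) (phi x)%:E)%E.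
  rewrite -integralZl//; last exact: integrable_itv.
  rewrite -integralD//; last 2 first.
  - exact: integrable_itv.
  - by apply: integrableZl => //; exact: integrable_itv.
  by apply: eq_integral => x _; rewrite -EFinM -EFinD subrK.
rewrite (@continuous_FTC2 _ g (F t)); last 4 first.
- by rewrite gtrN.
- exact: continuous_subspaceT.
- split.
  + by move=> x _; have [] := is_derive_F t x.
  + apply: cvg_at_right_filter; exact: continuous_F.
  + apply: cvg_at_left_filter; exact: continuous_F.
- by move=> x _; rewrite derive1E; have [] := is_derive_F t x.
have phiN : phi (- N) = phi N by rewrite !phiE sqrrN.
have FN : F t N - F t (- N) <= 0.
  rewrite /F phiN (_ : _ - _ = - (2 * (N * (N ^+ 2 + 2 * t + 1) * phi N))); last by ring.
  by rewrite oppr_le0 !mulr_ge0// ltW.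
rewrite -[leRHS]add0e -EFinB leeD ?lee_fin//.
rewrite -[leRHS]mule1 lee_wpmul2l// ?lee_fin//.
rewrite -(@integral_normal_pdf R 0 1).
apply: ge0_subset_integral => //.
- by apply/measurable_EFinP; exact: measurable_normal_pdf.
- by move=> x _; rewrite lee_fin; exact: phi_ge0.
Qed.

(** Monotone convergence along the intervals [-(i+1), i+1] carries the truncated bound to the whole
    line. *)
Lemma normal_prob_moment_le (t : R) :
  (\int[normal_prob 0 1]_x ((x ^+ 2 - 1 + t) ^+ 2)%:E <= (t ^+ 2 + 2)%:E)%E.
Proof.
have mg : measurable_fun [set: measurableTypeR R] (fun x : R => (x ^+ 2 - 1 + t) ^+ 2).
  apply: (@measurable_funX _ _ _ _ (fun x : R => x ^+ 2 - 1 + t)).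
  apply: measurable_funD => //; apply: measurable_funB => //.
rewrite ge0_integral_normal_prob; last 2 first.
- exact/measurable_EFinP.
- by move=> x; rewrite lee_fin sqr_ge0.
under eq_integral do rewrite -EFinM -/(f t _).
pose I (i : nat) : set R := `[- (i.+1%:R), i.+1%:R]%classic.
have UI : \bigcup_i I i = setT.
  rewrite -subTset => x _; have xb := archi_boundP (normr_ge0 x).
  exists (Num.bound `|x|) => //; rewrite /I/= in_itv/= -ler_norml (le_trans (ltW xb))//.
  by rewrite ler_nat.
have mf : measurable_fun [set: measurableTypeR R] (EFin \o f t).
  by apply/measurable_EFinP; exact: (continuous_measurable_fun (@continuous_f t)).
rewrite -UI.
have cvgI : (\int[lebesgue]_(x in I i) (f t x)%:E @[i --> \oo] -->
    \int[lebesgue]_(x in \bigcup_i I i) (f t x)%:E)%E.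
  apply: ge0_nondecreasing_set_cvg_integral => //.
  - move=> i j ij; apply/subsetPset => x; rewrite /I/= !in_itv/= => /andP[ix xi].
    have ij' : i.+1%:R <= j.+1%:R :> R by rewrite ler_nat.
    by rewrite (le_trans _ ix) ?lerN2// (le_trans xi).
  - by move=> i; exact: measurable_itv.
  - by move=> i; exact: measurable_funTS.
  - by move=> i x _; rewrite lee_fin mulr_ge0// sqr_ge0.
rewrite -(cvg_lim _ cvgI)//; apply: lime_le; first by apply/cvg_ex; eexists; exact: cvgI.
near=> i; apply: truncated_moment => //.
(* For N = i + 1 >= 1 one has N^2 >= N, so N^2 + 2t + 1 >= 0 once i >= -(2t + 1). *)
have i1 : 1 <= i.+1%:R :> R by rewrite ler1n.
have : - (2 * t + 1) <= i.+1%:R.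
  by rewrite (@le_trans _ _ i%:R)// ?ler_nat//; near: i; exact: nbhs_infty_ger.
nra.
Unshelve. all: by end_near. Qed.

End gaussian_moments.

Section ge0_integral_le.

Import HBNNSimple.

(** The integral of a nonnegative function is a supremum over the simple functions below it, hence
    monotone for arbitrary functions. This serves for [mu_hat], whose measurability is not
    established. *)
Lemma ge0_integral_le d (T : measurableType d) (R : realType)
    (mu : {measure set T -> \bar R}) (f g : T -> \bar R) :
  (forall x, 0 <= f x)%E -> (forall x, f x <= g x)%E ->
  (\int[mu]_x f x <= \int[mu]_x g x)%E.
Proof.
move=> f0 fg; rewrite !ge0_integralTE//; last by move=> x; exact: le_trans (fg x).
apply: ereal_sup_le => _ [h /= hf <-]; exists h => // x; exact: le_trans (fg x).
Qed.

End ge0_integral_le.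

Section std_gaussian_moments.
Context {R : realType}.

Lemma continuous_dotprod_sqr n : continuous (fun z : 'rV[R]_n => dotprod z z).
Proof.
rewrite (_ : (fun _ => _) = fun z => dotprod (0 - z) (0 - z)).
  exact: continuous_dotprodxx.
by apply/funext => z; rewrite sub0r dotprodNl dotprodNr opprK.
Qed.

Lemma measurable_dotprod_sqr n :
  measurable_fun [set: borel_rV R n] (fun z : 'rV[R]_n => dotprod z z).
Proof. by apply: continuous_measurable_rV; exact: continuous_dotprod_sqr. Qed.

(* With a free shift t the bound is closed under Tonelli, and no integrability
   of the signed cross terms is needed. *)
Lemma std_gaussian_moment_le n (t : R) :
  (\int[std_gaussian n]_z ((dotprod z z - n%:R + t) ^+ 2)%:E <=
   (t ^+ 2 + 2 * n%:R)%:E)%E.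
Proof.
have mS m u : measurable_fun [set: borel_rV R m]
    (fun z : 'rV[R]_m => ((dotprod z z - m%:R + u) ^+ 2)%:E).
  apply/measurable_EFinP; apply: (@measurable_funX _ _ _ _ (fun z : borel_rV R m => dotprod z z - m%:R + u)).
  apply: measurable_funD => //; apply: measurable_funB => //.
  exact: measurable_dotprod_sqr.
elim: n t => [|n IHn] t.
  rewrite integral_dirac// diracT mul1e lee_fin /dotprod big_ord0.
  by rewrite subr0 add0r mulr0 addr0.
rewrite ge0_integral_std_gaussianS//; last by move=> x; rewrite lee_fin sqr_ge0.
(* At a fixed first coordinate [x] the shift becomes x^2 - 1 + t, and the induction hypothesis
   bounds the inner integral. *)
apply: (@le_trans _ _ (\int[normal_prob 0 1]_x
    (((x ^+ 2 - 1 + t) ^+ 2)%:E + (2 * n%:R)%:E))%E).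
  apply: ge0_integral_le => [x|x]; first by apply: integral_ge0 => v _; rewrite lee_fin sqr_ge0.
  rewrite -EFinD; apply: le_trans (IHn (x ^+ 2 - 1 + t)).
  rewrite le_eqVlt; apply/orP; left; apply/eqP; apply: eq_integral => v _.
  by rewrite dotprod_row_mx -natr1; congr (_ ^+ 2)%:E; ring.
rewrite ge0_integralD//.
- rewrite integral_cst// (_ : (t ^+ 2 + 2 * n.+1%:R) = (t ^+ 2 + 2) + 2 * n%:R); last by rewrite -natr1; ring.
  rewrite EFinD leeD//; first exact: normal_prob_moment_le.
  by rewrite [X in (_ * X)%E]probability_setT mule1.
- by move=> x _; rewrite lee_fin sqr_ge0.
- apply/measurable_EFinP; apply: (@measurable_funX _ _ _ _ (fun x : R => x ^+ 2 - 1 + t)).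
  by apply: measurable_funD => //; exact: measurable_funB.
Qed.

Lemma std_gaussian_deviation_le n : (0 < n)%N ->
  (\int[@std_gaussian R n]_z (`|dotprod z z - n%:R|)%:E <=
   (Num.sqrt (2 * n%:R))%:E)%E.
Proof.
move=> n0; set c := Num.sqrt (2 * n%:R : R).
have n2 : 0 < 2 * n%:R :> R by rewrite mulr_gt0// ltr0n.
have c0 : 0 < c by rewrite sqrtr_gt0.
have cc : c ^+ 2 = 2 * n%:R by rewrite sqr_sqrtr// ltW.
have mS : measurable_fun [set: borel_rV R n]
    (fun z : 'rV[R]_n => (dotprod z z - n%:R)).
  by apply: measurable_funB => //; exact: measurable_dotprod_sqr.
have mS2 : measurable_fun [set: borel_rV R n]
    (fun z : 'rV[R]_n => ((dotprod z z - n%:R) ^+ 2)).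
  exact: (@measurable_funX _ _ _ _ (fun z : borel_rV R n => dotprod z z - n%:R)).
(* AM-GM: [2 c |S| <= S^2 + c^2] *)
apply: (@le_trans _ _ (\int[std_gaussian n]_z
   ((2 * c)^-1%:E * (((dotprod z z - n%:R) ^+ 2)%:E + (c ^+ 2)%:E)))%E).
  apply: ge0_integral_le => [z|z]; first by rewrite lee_fin.
  rewrite -EFinD -EFinM lee_fin mulrC ler_pdivlMr ?mulr_gt0//.
  rewrite -(real_normK (num_real (_ - _))); have := sqr_ge0 (`|dotprod z z - n%:R| - c).
  nra.
rewrite ge0_integralZl//; last first.
- by rewrite lee_fin invr_ge0 mulr_ge0// ltW.
- by move=> z _; rewrite -EFinD lee_fin addr_ge0// sqr_ge0.
- by apply: emeasurable_funD => //; exact/measurable_EFinP.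
rewrite ge0_integralD//; last first.
- by move=> z _; rewrite lee_fin sqr_ge0.
- exact/measurable_EFinP.
- by move=> z _; rewrite lee_fin sqr_ge0.
rewrite integral_cst// [X in (_ + _ * X)%E]probability_setT mule1.
(* The second moment bound at shift t = 0. *)
have h : (\int[std_gaussian n]_z ((dotprod z z - n%:R) ^+ 2)%:E <= (c ^+ 2)%:E)%E.
  have := std_gaussian_moment_le n (0 : R).
  by under eq_integral do rewrite addr0; rewrite expr0n add0r cc.
apply: (@le_trans _ _ ((2 * c)^-1%:E * ((c ^+ 2)%:E + (c ^+ 2)%:E))%E).
  by rewrite lee_wpmul2l ?leeD2r// lee_fin invr_ge0 mulr_ge0// ltW.
by rewrite -EFinD -EFinM lee_fin le_eqVlt; apply/orP; left; apply/eqP; field; rewrite gt_eqF.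
Qed.
End std_gaussian_moments.

(** * Expectation of the pointwise bound *)

Theorem theorem1p1 (R : realType) (n : nat) (n_ge1 : (1 <= n)%N)
    (K : 'rV[R]_n -> R) (K_norm : is_norm K)
    (mu : 'rV[R]_n) (sigma : R) (sigma_gt0 : 0 < sigma)
    (d : measure_display) (T : measurableType d) (P : probability T R)
    (Y : {RV P >-> borel_rV R n})
    (Y_gaussian : has_gaussian_law Y mu (sigma ^+ 2)%:M)
    (sigma_hat : {RV P >-> R})
    (d' : measure_display) (T' : measurableType d') (P' : probability T' R)
    (Z : {RV P' >-> borel_rV R n})
    (Z_gaussian : has_gaussian_law Z 0 1%:M) :
  let mu_hat (w : T) : 'rV[R]_n :=
    argmin K [set nu : 'rV[R]_n |
      euclidean_norm ((Y w : 'rV[R]_n) - nu) ^+ 2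
        <= n%:R * sigma_hat w ^+ 2] in
  ('E_P[fun w => (euclidean_norm (mu_hat w - mu) ^+ 2)%R]
      / (n%:R * sigma ^+ 2)%:E
    <= (16 / (n%:R * sigma) * K mu)%:E * 'E_P'[fun w => dual_norm K (Z w)]
       + (2 * Num.sqrt (2 / n%:R))%:E
       + 2%:E * 'E_P[fun w => (`|sigma_hat w ^+ 2 - sigma ^+ 2|)%R]
           / (sigma ^+ 2)%:E)%E.
Proof.
pose mu_hat (w : T) : 'rV[R]_n := argmin K [set nu : 'rV[R]_n |
  euclidean_norm ((Y w : 'rV[R]_n) - nu) ^+ 2 <= n%:R * sigma_hat w ^+ 2].
cbv zeta; rewrite !unlock.
have n_gt0 : 0 < n%:R :> R by rewrite ltr0n.
have s2_gt0 : 0 < sigma ^+ 2 by rewrite exprn_gt0.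
have K_ge0 : 0 <= K mu by case: K_norm.
have DK_ge0 := dual_norm_ge0 K_norm.
have mDK : measurable_fun [set: borel_rV R n] (fun y => (dual_norm K y)%:E).
  apply/measurable_EFinP; apply: continuous_measurable_rV.
  exact: dual_norm_continuous.
pose S (y : 'rV[R]_n) := `|dotprod y y - n%:R|.
have mS : measurable_fun [set: borel_rV R n] (fun y => (S y)%:E).
  apply/measurable_EFinP/measurableT_comp => //.
  by apply: measurable_funB => //; exact: measurable_dotprod_sqr.
(* This is (y - mu) / sigma, written as an affine map; [law_std] shows that it sends Y to a standard
   Gaussian vector. *)
pose std (y : 'rV[R]_n) := - (sigma^-1 *: mu) + sigma^-1 *: y.
have mstd : measurable_fun [set: borel_rV R n] (std : borel_rV R n -> borel_rV R n).
  exact: measurable_affine_rV.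
have stdE y : y - mu = sigma *: std y.
  by rewrite scalerDr scalerN !scalerA divff ?gt_eqF// !scale1r addrC.
have stdK z : std (mu + sigma *: z) = z.
  by rewrite /std scalerDr scalerA mulVf ?gt_eqF// scale1r addKr.
have law_std (g : 'rV[R]_n -> \bar R) : measurable_fun [set: borel_rV R n] g ->
    (forall y, 0 <= g y)%E ->
    (\int[P]_w g (std (Y w)) = \int[std_gaussian n]_z g z)%E.
  move=> mg g0; rewrite (has_gaussian_lawP (f := g \o std) sigma_gt0 Y_gaussian)//.
  - by apply: eq_integral => z _; rewrite /= stdK.
  - exact: (measurableT_comp mg mstd).
  - by move=> y; exact: g0.
have law_Z : (\int[P']_w (dual_norm K (Z w))%:E =
    \int[std_gaussian n]_z (dual_norm K z)%:E)%E.
  have Z1 : has_gaussian_law Z 0 (1 ^+ 2)%:M by rewrite expr1n.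
  rewrite (has_gaussian_lawP (f := fun y => (dual_norm K y)%:E) ltr01 Z1)//.
  - by apply: eq_integral => z _; rewrite add0r scale1r.
set A := (\int[P']_w (dual_norm K (Z w))%:E)%E.
set B := (\int[P]_w (`|sigma_hat w ^+ 2 - sigma ^+ 2|)%:E)%E.
have A_ge0 : (0 <= A)%E by apply: integral_ge0 => w _; rewrite lee_fin.
have B_ge0 : (0 <= B)%E by apply: integral_ge0 => w _; rewrite lee_fin.
have bound w : euclidean_norm (mu_hat w - mu) ^+ 2 <=
    4 * K mu * sigma * dual_norm K (std (Y w)) + sigma ^+ 2 * S (std (Y w)) +
    n%:R * `|sigma_hat w ^+ 2 - sigma ^+ 2|.
  have L_ge0 : 0 <= n%:R * sigma_hat w ^+ 2 by rewrite mulr_ge0// sqr_ge0.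
  apply: le_trans (argmin_ball_sqr_dist_le K_norm (Y w) L_ge0 mu) _.
  rewrite stdE dotprodZl dotprodZr -addrA; apply: lerD.
    rewrite -[leRHS]mulrA ler_wpM2l ?mulr_ge0//.
    by rewrite dual_normZ_le// ltW.
  rewrite [X in _ <= X + _](_ : _ = `|sigma ^+ 2 * (dotprod (std (Y w)) (std (Y w)) - n%:R)|); last first.
    by rewrite normrM gtr0_norm.
  rewrite [X in _ <= _ + X](_ : _ = `|n%:R * (sigma_hat w ^+ 2 - sigma ^+ 2)|); last first.
    by rewrite normrM gtr0_norm.
  (* The triangle inequality for ||Y - mu||^2 - n sigma_hat^2 = sigma^2 (||std Y||^2 - n) - n
     (sigma_hat^2 - sigma^2). *)
  apply: le_trans (ler_normB _ _).
  by rewrite le_eqVlt; apply/orP; left; apply/eqP; congr `|_|; ring.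
have int_bound : (\int[P]_w (euclidean_norm (mu_hat w - mu) ^+ 2)%:E <=
    (4 * K mu * sigma)%:E * A + (sigma ^+ 2 * Num.sqrt (2 * n%:R))%:E + n%:R%:E * B)%E.
  have c_ge0 : 0 <= 4 * K mu * sigma by rewrite !mulr_ge0// ltW.
  have mY : measurable_fun [set: T] ((fun w => std (Y w)) : T -> borel_rV R n).
    by apply: (measurableT_comp mstd).
  have mD : measurable_fun [set: T] (fun w => (dual_norm K (std (Y w)))%:E).
    exact: (measurableT_comp mDK mY).
  have mSY : measurable_fun [set: T] (fun w => (S (std (Y w)))%:E).
    exact: (measurableT_comp mS mY).
  have mB : measurable_fun [set: T] (fun w => (`|sigma_hat w ^+ 2 - sigma ^+ 2|)%:E).
    apply/measurable_EFinP/measurableT_comp => //.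
    by apply: measurable_funB => //; exact: measurable_funX.
  (* The left integrand enters only through monotonicity; linearity is applied to the measurable
     upper bound. *)
  apply: (@le_trans _ _ (\int[P]_w ((4 * K mu * sigma)%:E * (dual_norm K (std (Y w)))%:E
     + (sigma ^+ 2)%:E * (S (std (Y w)))%:E
     + n%:R%:E * (`|sigma_hat w ^+ 2 - sigma ^+ 2|)%:E))%E).
    apply: ge0_integral_le => w; first by rewrite lee_fin sqr_ge0.
    by rewrite -!EFinM -!EFinD lee_fin.
  have s2_ge0 := ltW s2_gt0; have n_ge0 := ltW n_gt0.
  have scaled (c : R) (h : T -> R) : 0 <= c -> (forall w, 0 <= h w) ->
      measurable_fun [set: T] (fun w => (h w)%:E) ->
      [/\ forall w, [set: T] w -> (0 <= c%:E * (h w)%:E)%E,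
          measurable_fun [set: T] (fun w => c%:E * (h w)%:E)%E &
          (\int[P]_w (c%:E * (h w)%:E) = c%:E * \int[P]_w (h w)%:E)%E].
    move=> c0 h0 mh; split; first by move=> w _; rewrite -EFinM lee_fin mulr_ge0.
      exact: emeasurable_funM.
    by rewrite ge0_integralZl// => w _; rewrite lee_fin.
  have [p1 m1 e1] := scaled _ (fun w => dual_norm K (std (Y w))) c_ge0 (fun w => DK_ge0 _) mD.
  have [p2 m2 e2] := scaled _ (fun w => S (std (Y w))) s2_ge0 (fun w => normr_ge0 _) mSY.
  have [p3 m3 e3] := scaled _ (fun w => `|sigma_hat w ^+ 2 - sigma ^+ 2|) n_ge0 (fun w => normr_ge0 _) mB.
  rewrite (ge0_integralD _ measurableT _ (emeasurable_funD m1 m2) p3 m3); last first.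
    by move=> w _; rewrite adde_ge0// ?p1 ?p2.
  rewrite (ge0_integralD _ measurableT p1 m1 p2 m2) e1 e2 e3.
  rewrite leeD2r// leeD//.
    by rewrite /A law_Z (law_std (fun y => (dual_norm K y)%:E)).
  rewrite (law_std (fun y => (S y)%:E))//; last by move=> y; rewrite lee_fin normr_ge0.
  rewrite [leRHS]EFinM; apply: lee_wpmul2l; first by rewrite lee_fin.
  exact: std_gaussian_deviation_le.
have V_gt0 : 0 < n%:R * sigma ^+ 2 by rewrite mulr_gt0.
have Vn : (0 <= ((n%:R * sigma ^+ 2)^-1)%:E)%E by rewrite lee_fin invr_ge0 ltW.
rewrite !inver !gt_eqF//.
apply: le_trans (lee_wpmul2r Vn int_bound) _.
have sqrt2n : Num.sqrt (2 * n%:R) = Num.sqrt (2 / n%:R) * n%:R :> R.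
  rewrite (_ : 2 * n%:R = 2 / n%:R * n%:R ^+ 2); last by field; rewrite gt_eqF.
  by rewrite sqrtrM ?sqrtr_sqr ?(gtr0_norm n_gt0)// divr_ge0// ltW.
have t1 : (0 <= (4 * K mu * sigma)%:E * A)%E.
  by rewrite mule_ge0// lee_fin !mulr_ge0// ltW.
have t2 : (0 <= (sigma ^+ 2 * Num.sqrt (2 * n%:R))%:E)%E.
  by rewrite lee_fin mulr_ge0 ?sqrtr_ge0// ltW.
have t3 : (0 <= n%:R%:E * B)%E by rewrite mule_ge0// lee_fin ltW.
rewrite (ge0_muleDl _ (adde_ge0 t1 t2) t3) (ge0_muleDl _ t1 t2).
(* Term by term, the division leaves the constants 4, 1 and 1, against 16, 2 and 2 in the claim. *)
apply: leeD; first apply: leeD.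
- rewrite muleAC -EFinM lee_wpmul2r// lee_fin.
  rewrite [leLHS](_ : _ = 4 / (n%:R * sigma) * K mu); last first.
    by field; rewrite !gt_eqF.
  by rewrite !ler_wpM2r// ?ler_nat// invr_ge0 mulr_ge0 ?ltW.
- rewrite -EFinM lee_fin sqrt2n [leLHS](_ : _ = Num.sqrt (2 / n%:R)); last first.
    by field; rewrite !gt_eqF.
  by rewrite ler_peMl ?sqrtr_ge0// ler1n.
- rewrite muleAC -EFinM [leRHS]muleAC -EFinM lee_wpmul2r// lee_fin.
  rewrite [leLHS](_ : _ = 1 * sigma ^- 2); last by field; rewrite !gt_eqF.
  by rewrite ler_wpM2r ?ler1n// invr_ge0 ltW.
Qed.
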